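(* For every dimension $d\ge 1$ and every noise level $\delta>0$, the limit $\mathrm{OPT}_d(\infty,\delta):=\lim_{T\to\infty}\mathrm{OPT}_d(T,\delta)$ exists and \[ \mathrm{OPT}_d(\infty,\delta)=\sqrt{\frac{2d}{d+1}}\,\delta . \]
   Context: Linear reconstruction game: fix $d\ge 1$, a number of rounds $T\ge 0$ and a noise level $\delta>0$. An adversary holds a secret point $x^*\in\mathbb{R}^d$. In each round $t=1,\dots,T$ the reconstructor chooses a unit vector $v_t\in S^{d-1}$ (possibly adaptively, as a function of previous answers) and the adversary returns a real number $r_t$ with $|r_t-\langle x^*,v_t\rangle|\le\delta$. After $T$ rounds the reconstructor outputs $\hat x_T\in\mathbb{R}^d$. All strategies are deterministic. The optimal reconstruction error is $\mathrm{OPT}_d(T,\delta)=\inf_{\mathcal R}\sup_{x^*\in\mathbb{R}^d}\sup_{\mathcal A}\|\hat x_T-x^*\|_2$, where $\mathcal R$ ranges over reconstructor strategies for $T$ rounds and $\mathcal A$ over adversary answer strategies satisfying the noise constraint for the secret $x^*$. *)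

(* Defs.v *)
From HB Require Import structures.
From mathcomp Require Import all_boot all_order all_algebra.
From mathcomp Require Import all_classical all_reals all_analysis.
Set Implicit Arguments. Unset Strict Implicit. Unset Printing Implicit Defensive.
Import Order.TTheory GRing.Theory Num.Theory.
Local Open Scope ring_scope.
Local Open Scope classical_set_scope.

Section Game.
Variables (R : realType) (d : nat).

Definition dotp (x y : 'rV[R]_d) : R := \sum_(i < d) x 0 i * y 0 i.
Definition enorm (x : 'rV[R]_d) : R := Num.sqrt (dotp x x).

(* A deterministic reconstructor: [query h] is the next unit query vector
   given the previous answers h, [output h] the final estimate given all
   answers.  An adversary answer strategy [a h v] gives the answer to query
   v given the past transcript h (list of (query, answer) pairs). *)
Fixpoint transcript (query : seq R -> 'rV[R]_d)
    (a : seq ('rV[R]_d * R) -> 'rV[R]_d -> R) (t : nat)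
    : seq ('rV[R]_d * R) :=
  match t with
  | 0 => [::]
  | t'.+1 => let h := transcript query a t' in
             let v := query (map snd h) in
             rcons h (v, a h v)
  end.

Definition valid_adv (x : 'rV[R]_d) (delta : R)
    (a : seq ('rV[R]_d * R) -> 'rV[R]_d -> R) : Prop :=
  forall h v, `| a h v - dotp x v | <= delta.

Definition recon_error (query : seq R -> 'rV[R]_d) (output : seq R -> 'rV[R]_d)
    (a : seq ('rV[R]_d * R) -> 'rV[R]_d -> R) (x : 'rV[R]_d) (T : nat) : R :=
  enorm (output (map snd (transcript query a T)) - x).

Definition worst_error (query : seq R -> 'rV[R]_d) (output : seq R -> 'rV[R]_d)
    (T : nat) (delta : R) : \bar R :=
  ereal_sup [set e | exists x a, valid_adv x delta a /\
                                 e = (recon_error query output a x T)%:E].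

Definition OPT (T : nat) (delta : R) : \bar R :=
  ereal_inf [set e | exists (query : seq R -> 'rV[R]_d) (output : seq R -> 'rV[R]_d),
      (forall h, enorm (query h) = 1) /\ e = worst_error query output T delta].

End Game.

(* Main.v *)
(* Upper bound: querying a fine net of directions leaves a consistent set of
   diameter at most (2 + o(1)) delta, and Jung's theorem puts it in a ball of
   radius sqrt (d / (2 (d + 1))) times its diameter.  Jung's theorem comes from
   maximising the variance of finitely supported probability measures on the
   set: the support can be cut down to d + 1 points, which bounds the variance,
   and the mean of a near-maximiser is a near-centre, so no compactness is used.
   Lower bound: against the vertices of a regular simplex of side 2 delta, the
   midpoint of the projected simplex is a legal answer for every vertex; the
   variance of the uniform measure on the vertices then shows that every output
   is at distance at least the circumradius from some vertex. *)
Require Import Defs.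
From HB Require Import structures.
From mathcomp Require Import all_boot all_order all_algebra.
From mathcomp Require Import all_classical all_reals all_analysis.
From mathcomp Require Import ring lra.
Import Order.TTheory GRing.Theory Num.Theory.
Local Open Scope ring_scope.
Local Open Scope classical_set_scope.

(** * Bilinearity of [dotp] and the Euclidean norm *)

Section InnerProduct.
Context {R : realType} {d : nat}.
Implicit Types (x y z : 'rV[R]_d) (k : R).

Lemma dotpC x y : dotp x y = dotp y x.
Proof. by apply: eq_bigr => i _; rewrite mulrC. Qed.

Lemma dotpDl x y z : dotp (x + y) z = dotp x z + dotp y z.
Proof. by rewrite -big_split; apply: eq_bigr => i _; rewrite mxE mulrDl. Qed.

Lemma dotpZl k x y : dotp (k *: x) y = k * dotp x y.
Proof. by rewrite /dotp mulr_sumr; apply: eq_bigr => i _; rewrite mxE mulrA. Qed.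

Lemma dotpNl x y : dotp (- x) y = - dotp x y.
Proof. by rewrite -scaleN1r dotpZl mulN1r. Qed.

Lemma dotpBl x y z : dotp (x - y) z = dotp x z - dotp y z.
Proof. by rewrite dotpDl dotpNl. Qed.

Lemma dotpDr x y z : dotp z (x + y) = dotp z x + dotp z y.
Proof. by rewrite ![dotp z _]dotpC dotpDl. Qed.

Lemma dotpZr k x y : dotp x (k *: y) = k * dotp x y.
Proof. by rewrite ![dotp x _]dotpC dotpZl. Qed.

Lemma dotpBr x y z : dotp z (x - y) = dotp z x - dotp z y.
Proof. by rewrite ![dotp z _]dotpC dotpBl. Qed.

Lemma dotp0l y : dotp 0 y = 0.
Proof. by rewrite -(scale0r y) dotpZl mul0r. Qed.

Lemma dotp_suml n (f : 'I_n -> 'rV[R]_d) y :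
  dotp (\sum_i f i) y = \sum_i dotp (f i) y.
Proof.
elim: n f => [|n IH] f; first by rewrite !big_ord0 dotp0l.
by rewrite !big_ord_recl dotpDl IH.
Qed.

Lemma dotp_ge0 x : 0 <= dotp x x.
Proof. by apply: sumr_ge0 => i _; rewrite -expr2 sqr_ge0. Qed.

Lemma dotp_eq0 x : dotp x x = 0 -> x = 0.
Proof.
move=> /eqP; rewrite psumr_eq0; last by move=> i _; rewrite -expr2 sqr_ge0.
move=> /allP h; apply/rowP => i; rewrite mxE; apply/eqP.
by have := h i; rewrite mem_index_enum mulf_eq0 orbb => /(_ isT).
Qed.

Lemma dotp_sqrB x y : dotp (x - y) (x - y) = dotp x x - 2 * dotp x y + dotp y y.
Proof. rewrite !dotpBl !dotpBr (dotpC y x); ring. Qed.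

Lemma dotp_subC x y : dotp (x - y) (x - y) = dotp (y - x) (y - x).
Proof. by rewrite !dotp_sqrB (dotpC x); ring. Qed.

Lemma enorm_ge0 x : 0 <= enorm x.
Proof. exact: sqrtr_ge0. Qed.

Lemma sqr_enorm x : enorm x ^+ 2 = dotp x x.
Proof. by rewrite sqr_sqrtr ?dotp_ge0. Qed.

Lemma enorm_gt0 x : x != 0 -> 0 < enorm x.
Proof.
rewrite lt_neqAle enorm_ge0 andbT [0 == _]eq_sym; apply: contra => /eqP ex.
by apply/eqP; apply: dotp_eq0; rewrite -sqr_enorm ex expr0n.
Qed.

Lemma dotp_normalize x : x != 0 ->
  dotp ((enorm x)^-1 *: x) ((enorm x)^-1 *: x) = 1.
Proof.
move=> x0; rewrite dotpZl dotpZr -sqr_enorm; field.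
by rewrite gt_eqF ?enorm_gt0.
Qed.

Lemma enorm_le x k : 0 <= k -> (enorm x <= k) = (dotp x x <= k ^+ 2).
Proof. by move=> k0; rewrite -sqr_enorm ler_sqr ?nnegrE ?enorm_ge0. Qed.

Lemma enorm_ge x k : 0 <= k -> (k <= enorm x) = (k ^+ 2 <= dotp x x).
Proof. by move=> k0; rewrite -sqr_enorm ler_sqr ?nnegrE ?enorm_ge0. Qed.

(** Cauchy-Schwarz against a unit vector, from the nonnegative square of [x - dotp x v *: v]. *)
Lemma dotp_unit_le x v k :
  0 <= k -> enorm v = 1 -> dotp x x <= k ^+ 2 -> dotp x v <= k.
Proof.
move=> k0 v1 xk; rewrite leNgt; apply/negP => kv.
have vv : dotp v v = 1 by rewrite -sqr_enorm v1 expr1n.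
have := dotp_ge0 (x - dotp x v *: v).
rewrite dotp_sqrB !dotpZr !dotpZl vv.
have : k ^+ 2 < dotp x v ^+ 2 by rewrite ltr_sqr ?nnegrE// (le_trans k0 (ltW kv)).
rewrite !expr2 => h1 h2; rewrite expr2 in xk; nra.
Qed.

End InnerProduct.

(** * Variance of weighted points and Jung's theorem *)

Section WeightedVariance.
Context {R : realType} {d : nat}.
Implicit Types (n : nat) (c : 'rV[R]_d).

Definition wmean {n} (l : 'I_n -> R) (p : 'I_n -> 'rV[R]_d) := \sum_i l i *: p i.

Definition wvar {n} (l : 'I_n -> R) (p : 'I_n -> 'rV[R]_d) :=
  \sum_i l i * dotp (p i) (p i) - dotp (wmean l p) (wmean l p).

(** The parallel axis theorem: once the squares are expanded, the cross terms see only the mean. *)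
Lemma wvar_center {n} (l : 'I_n -> R) (p : 'I_n -> 'rV[R]_d) c : \sum_i l i = 1 ->
  \sum_i l i * dotp (p i - c) (p i - c)
    = wvar l p + dotp (wmean l p - c) (wmean l p - c).
Proof.
move=> l1; rewrite /wvar dotp_sqrB.
have -> : dotp (wmean l p) c = \sum_i l i * dotp (p i) c.
  by rewrite dotp_suml; apply: eq_bigr => i _; rewrite dotpZl.
transitivity (\sum_i (l i * dotp (p i) (p i) - 2 * (l i * dotp (p i) c)
    + l i * dotp c c)).
  by apply: eq_bigr => i _; rewrite dotp_sqrB; ring.
rewrite big_split big_split /= sumrN -mulr_sumr -mulr_suml l1; ring.
Qed.

(** Averaging [wvar_center] over the centres [p i] counts the variance twice. *)
Lemma wvar_pairs {n} (l : 'I_n -> R) (p : 'I_n -> 'rV[R]_d) : \sum_i l i = 1 ->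
  2 * wvar l p = \sum_i \sum_j l i * l j * dotp (p i - p j) (p i - p j).
Proof.
move=> l1.
transitivity (\sum_i l i *
    (wvar l p + dotp (p i - wmean l p) (p i - wmean l p))).
  under eq_bigr do rewrite mulrDr.
  rewrite big_split /= -mulr_suml l1 wvar_center// subrr dotp0l; ring.
apply: eq_bigr => i _.
rewrite dotp_subC -wvar_center// mulr_sumr; apply: eq_bigr => j _.
by rewrite dotp_subC mulrA.
Qed.

(** Diagonal pairs vanish, so twice the variance is at most [D * (1 - \sum_i l i ^+ 2)]; at most d +
    1 weights of total 1 have sum of squares at least 1 / (d + 1). *)
Lemma wvar_le_support {n} (l : 'I_n -> R) (p : 'I_n -> 'rV[R]_d) D :
  (forall i, 0 <= l i) -> \sum_i l i = 1 -> (n <= d.+1)%N ->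
  (forall i j, dotp (p i - p j) (p i - p j) <= D) ->
  wvar l p <= D / 2 * (d%:R / (d%:R + 1)).
Proof.
move=> l0 l1 nd pD.
have D0 : 0 <= D.
  case: n l p l0 l1 nd pD => [|n] l p l0 l1 nd pD.
    by move: l1; rewrite big_ord0 => /esym/eqP; rewrite oner_eq0.
  by apply: le_trans (pD ord0 ord0); exact: dotp_ge0.
have d0 : 0 <= d%:R :> R by [].
set e : R := (d%:R + 1)^-1.
have e0 : 0 < e by rewrite invr_gt0; lra.
have de : (d%:R + 1) * e = 1 by rewrite mulfV//; lra.
have sq : e <= \sum_i l i ^+ 2.
  have : 0 <= \sum_i (l i - e) ^+ 2 by apply: sumr_ge0 => i _; exact: sqr_ge0.
  have -> : \sum_i (l i - e) ^+ 2 = \sum_i l i ^+ 2 - 2 * e + n%:R * e ^+ 2.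
    transitivity (\sum_i (l i ^+ 2 - 2 * e * l i + e ^+ 2)).
      by apply: eq_bigr => i _; ring.
    rewrite big_split big_split /= sumrN -mulr_sumr l1 sumr_const card_ord.
    by rewrite [n%:R * _]mulr_natl mulr1.
  have : n%:R * e ^+ 2 <= (d%:R + 1) * e ^+ 2.
    by rewrite ler_wpM2r ?sqr_ge0// -[X in _ + X]/(1%:R) -natrD ler_nat addn1.
  have -> : (d%:R + 1) * e ^+ 2 = e by rewrite expr2 mulrA de mul1r.
  lra.
have : 2 * wvar l p <= D * (1 - \sum_i l i ^+ 2).
  rewrite wvar_pairs// -{1}l1 -sumrB mulr_sumr; apply: ler_sum => i _.
  rewrite (bigD1 i)//= subrr dotp0l mulr0 add0r.
  apply: le_trans (_ : \sum_(j | j != i) l i * l j * D <= _).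
    by apply: ler_sum => j _; rewrite ler_wpM2l ?mulr_ge0.
  rewrite -mulr_suml -mulr_sumr.
  have -> : \sum_(j | j != i) l j = 1 - l i by rewrite -l1 [in RHS](bigD1 i)//=; ring.
  by rewrite [leRHS]mulrC expr2 mulrBr mulr1.
have : D * e <= D * \sum_i l i ^+ 2 by rewrite ler_wpM2l.
have -> : d%:R * e = 1 - e by lra.
nra.
Qed.

(* Moving the weights along an affine dependency of the points keeps the mean
   and changes the variance affinely, so some support point can be dropped
   without decreasing the variance. *)
Lemma wvar_drop {n} (l : 'I_n.+1 -> R) (p : 'I_n.+1 -> 'rV[R]_d) :
  (forall i, 0 <= l i) -> \sum_i l i = 1 -> (d < n)%N ->
  exists (i0 : 'I_n.+1) (l' : 'I_n -> R),
    [/\ forall i, 0 <= l' i, \sum_i l' i = 1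
      & wvar l p <= wvar l' (fun i => p (lift i0 i))].
Proof.
move=> l0 l1 dn.
have [m [m0 m1 mp ms]] : exists m : 'I_n.+1 -> R,
  [/\ exists i, m i != 0, \sum_i m i = 0, \sum_i m i *: p i = 0
    & 0 <= \sum_i m i * dotp (p i) (p i)].
  (* The rows are the points with a 1 appended, so the left kernel consists of the affine
     dependencies; it is nonzero because n + 1 exceeds d + 1. *)
  pose M : 'M[R]_(n.+1, d + 1) :=
    row_mx (\matrix_(i, j) p i 0 j) (const_mx 1).
  have kM : kermx M != 0.
    rewrite kermx_eq0 -row_leq_rank -ltnNge.
    by rewrite (leq_ltn_trans (rank_leq_col _))// addn1 ltnS.
  have /rowV0Pn[u /sub_kermxP uM u0] := kM.
  have [i ui] : exists i, u 0 i != 0.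
    apply/existsP; apply: contraNT u0 => /existsPn h.
    by apply/eqP/rowP => i; rewrite mxE; apply/eqP; rewrite -[_ == _]negbK.
  move: uM; rewrite mul_mx_row -[0 in RHS]row_mx0 => /eq_row_mx[uP u1].
  have s1 : \sum_i u 0 i = 0.
    have /rowP/(_ 0) := u1; rewrite !mxE => h; rewrite -[RHS]h.
    by apply: eq_bigr => j _; rewrite mxE mulr1.
  have sp : \sum_i u 0 i *: p i = 0.
    apply/rowP => j; have /rowP/(_ j) := uP; rewrite summxE !mxE => h; rewrite -[RHS]h.
    by apply: eq_bigr => k _; rewrite !mxE.
  (* Up to a change of sign, the second moment does not decrease along the dependency. *)
  have [s0|s0] := lerP 0 (\sum_i u 0 i * dotp (p i) (p i)).
    by exists (u 0); split=> //; exists i.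
  exists (fun i => - u 0 i); split.
  - by exists i; rewrite oppr_eq0.
  - by rewrite sumrN s1 oppr0.
  - by under eq_bigr do rewrite scaleNr; rewrite sumrN sp oppr0.
  - by under eq_bigr do rewrite mulNr; rewrite sumrN oppr_ge0 ltW.
have [i1 mi1] : exists i, m i < 0.
  apply/existsP; case: m0 => i mi; apply: contraNT mi => /existsPn h.
  have : \sum_i m i == 0 by rewrite m1.
  rewrite psumr_eq0; last by move=> j _; rewrite leNgt.
  by move=> /allP/(_ i); rewrite mem_index_enum => /(_ isT).
(* The smallest ratio is the longest step that keeps all weights nonnegative, and it brings the
   weight of [i0] to zero. *)
case: (@Order.TotalTheory.arg_minP _ _ _ i1 (fun i => m i < 0)
  (fun i => l i / - m i) mi1) => i0 mi0 tmin.
set t := l i0 / - m i0 in tmin.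
have t0 : 0 <= t by rewrite divr_ge0// oppr_ge0 ltW.
pose k i := l i + t * m i.
have k0 i : 0 <= k i.
  have [mi|mi] := ltP (m i) 0; last by exact: addr_ge0 (l0 i) (mulr_ge0 t0 mi).
  have := tmin _ mi; rewrite ler_pdivlMr ?oppr_gt0// mulrN /k; lra.
have ki0 : k i0 = 0 by rewrite /k /t; field; rewrite lt_eqF.
have k1 : \sum_i k i = 1.
  by rewrite big_split /= -mulr_sumr m1 mulr0 addr0.
have wk : wmean k p = wmean l p.
  rewrite /wmean; under eq_bigr do rewrite scalerDl -scalerA.
  by rewrite big_split /= -scaler_sumr mp scaler0 addr0.
exists i0, (fun i => k (lift i0 i)); split=> //.
  by rewrite -k1 (bigD1_ord i0)//= ki0 add0r.
have -> : wvar (fun i => k (lift i0 i)) (fun i => p (lift i0 i)) = wvar k p.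
  rewrite /wvar; congr (_ - _).
    by rewrite [RHS](bigD1_ord i0)//= ki0 mul0r add0r.
  by rewrite /wmean !(bigD1_ord i0 (P := xpredT))//= ki0 scale0r add0r.
rewrite /wvar wk lerD2r.
under [leRHS]eq_bigr do rewrite /k mulrDl -mulrA.
by rewrite big_split /= -mulr_sumr lerDl mulr_ge0.
Qed.

Lemma wvar_le {n} (l : 'I_n -> R) (p : 'I_n -> 'rV[R]_d) D :
  (forall i, 0 <= l i) -> \sum_i l i = 1 ->
  (forall i j, dotp (p i - p j) (p i - p j) <= D) ->
  wvar l p <= D / 2 * (d%:R / (d%:R + 1)).
Proof.
elim: n l p => [|n IH] l p l0 l1 pD; first exact: wvar_le_support.
have [nd|dn] := leqP n d; first exact: wvar_le_support.
have [i0 [l' [l'0 l'1]]] := wvar_drop l p l0 l1 dn.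
by move=> /le_trans; apply; apply: IH.
Qed.

(** Variance of a mixture: the part within the old points, plus the part between their mean and the
    single point [q]. *)
Lemma wvar_adjoin {n} (l : 'I_n -> R) (p : 'I_n -> 'rV[R]_d) q t :
  wvar (fun i => if unlift ord0 i is Some j then (1 - t) * l j else t)
       (fun i => if unlift ord0 i is Some j then p j else q)
  = (1 - t) * wvar l p + t * (1 - t) * dotp (q - wmean l p) (q - wmean l p).
Proof.
rewrite /wvar; set c := wmean l p.
have -> : wmean (fun i => if unlift ord0 i is Some j then (1 - t) * l j else t)
    (fun i => if unlift ord0 i is Some j then p j else q)
    = t *: q + (1 - t) *: c.
  rewrite /wmean big_ord_recl unlift_none scaler_sumr; congr (_ + _).
  by apply: eq_bigr => i _; rewrite liftK scalerA.
rewrite big_ord_recl unlift_none.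
under eq_bigr do rewrite liftK -mulrA.
rewrite -mulr_sumr dotp_sqrB.
rewrite !(dotpDl, dotpDr, dotpZl, dotpZr) (dotpC c q); ring.
Qed.

(* The centre is the mean of a nearly variance-maximising weight: mixing in a
   far point [q] would increase the variance. *)
Lemma jung_approx (K : set 'rV[R]_d) D C :
  (forall x y, K x -> K y -> dotp (x - y) (x - y) <= D) ->
  D / 2 * (d%:R / (d%:R + 1)) < C ->
  exists c, forall q, K q -> dotp (q - c) (q - c) <= C.
Proof.
move=> KD DC.
have [->|/set0P[x0 Kx0]] := eqVneq K set0; first by exists 0.
pose V := [set v | exists n (l : 'I_n -> R) p,
  [/\ forall i, 0 <= l i, \sum_i l i = 1, forall i, K (p i) & v = wvar l p]].
have V0 : V 0.
  exists 1%N, (fun=> 1), (fun=> x0); split=> //; first by rewrite big_ord1.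
  by rewrite /wvar /wmean !big_ord1 scale1r mul1r subrr.
have Vub : ubound V (D / 2 * (d%:R / (d%:R + 1))).
  move=> _ [n [l [p [l0 l1 Kp ->]]]]; apply: wvar_le => // i j.
  exact: KD.
have supV : has_sup V by split; [exists 0 | exists (D / 2 * (d%:R / (d%:R + 1)))].
set S := sup V.
have S0 : 0 <= S by apply: ub_le_sup => //; case: supV.
have SC : S < C by apply: le_lt_trans DC; apply: ge_sup => //; exists 0.
have C0 : 0 < C by exact: le_lt_trans SC.
(* This makes [C * (1 - t)] the midpoint of [C] and [S], hence above [S]. The slack
   [t * (C - S / (1 - t))] is then positive, and a weight within it of [S] is pushed past [S] by
   mixing in [q]. *)
pose t := (C - S) / (2 * C).
have t0 : 0 < t by rewrite divr_gt0 ?subr_gt0 ?mulr_gt0.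
have t1 : t < 1 by rewrite ltr_pdivrMr; lra.
have eta0 : 0 < t * (C - S / (1 - t)).
  rewrite mulr_gt0// subr_gt0 ltr_pdivrMr ?subr_gt0//.
  have -> : C * (1 - t) = (C + S) / 2 by rewrite /t; field; rewrite gt_eqF.
  lra.
have [_ [n [l [p [l0 l1 Kp ->]]]] wS] := sup_adherent eta0 supV.
exists (wmean l p) => q Kq; rewrite leNgt; apply/negP => qC.
pose l' i := if unlift ord0 i is Some j then (1 - t) * l j else t.
pose p' i := if unlift ord0 i is Some j then p j else q.
have t1' : 0 < 1 - t by rewrite subr_gt0.
have : wvar l' p' <= S.
  apply: ub_le_sup; first by case: supV.
  exists n.+1, l', p'; split=> //.
  - move=> i; rewrite /l'; case: (unliftP ord0 i) => [j|] _; last exact: ltW.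
    by rewrite mulr_ge0// ltW.
  - rewrite /l' big_ord_recl unlift_none.
    under eq_bigr do rewrite liftK.
    by rewrite -mulr_sumr l1; ring.
  - by move=> i; rewrite /p'; case: (unliftP ord0 i).
rewrite wvar_adjoin leNgt => /negP; apply.
have -> : S = (1 - t) * (S - t * (C - S / (1 - t)) + t * C).
  by field; rewrite gt_eqF.
rewrite -mulrA mulrCA -mulrDr ltr_pM2l// ltrD// ltr_pM2l//.
Qed.

End WeightedVariance.

(** * Lower bound: the simplex adversary *)

Section LowerBound.
Context {R : realType} {d : nat}.
Implicit Types (delta : R) (x v : 'rV[R]_d).

Lemma dotp_delta x j : dotp x (delta_mx 0 j) = x 0 j.
Proof.
rewrite /dotp (bigD1 j)//= mxE !eqxx mulr1 big1 ?addr0// => i ij.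
by rewrite mxE (negbTE ij) andbF mulr0.
Qed.

(* Up to scaling, the standard basis together with the multiple of (1,..,1)
   lying at distance [sqrt 2] from every basis vector. *)
Lemma regular_simplex delta : exists p : 'I_d.+1 -> 'rV[R]_d,
  forall i j, i != j -> dotp (p i - p j) (p i - p j) = (2 * delta) ^+ 2.
Proof.
pose s : R := Num.sqrt 2 * delta.
have s2 : s ^+ 2 = 2 * delta ^+ 2 by rewrite exprMn sqr_sqrtr.
pose w : R := Num.sqrt (d%:R + 1).
have w0 : 0 <= w by exact: sqrtr_ge0.
have w2 : w ^+ 2 = d%:R + 1 by rewrite sqr_sqrtr// addr_ge0.
(* A root of the quadratic in [gE], which says that [const_mx g] is at squared distance [2 * s ^+ 2]
   from each [s *: delta_mx 0 j]. The denominator [1 + w] is nonzero even for d = 0. *)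
pose g : R := - s / (1 + w).
have gE : d%:R * g ^+ 2 - 2 * s * g = s ^+ 2.
  have -> : d%:R = w ^+ 2 - 1 by rewrite w2; ring.
  by rewrite /g; field; lra.
pose p (i : 'I_d.+1) : 'rV[R]_d :=
  if unlift ord0 i is Some j then s *: delta_mx 0 j else const_mx g.
have sg (j : 'I_d) : dotp (s *: delta_mx 0 j - const_mx g)
                 (s *: delta_mx 0 j - const_mx g) = (2 * delta) ^+ 2.
  rewrite dotp_sqrB !(dotpZl, dotpZr) dotp_delta.
  rewrite (dotpC (delta_mx 0 j)) dotp_delta !mxE !eqxx /=.
  have -> : dotp (const_mx g) (const_mx g : 'rV[R]_d) = d%:R * g ^+ 2.
    rewrite /dotp; transitivity (\sum_(i < d) g * g).
      by apply: eq_bigr => i _; rewrite mxE.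
    by rewrite sumr_const card_ord -[LHS]mulr_natl expr2.
  transitivity (s ^+ 2 + (d%:R * g ^+ 2 - 2 * s * g)); first by ring.
  by rewrite gE s2; ring.
exists p => i j; rewrite /p.
case: (unliftP ord0 i) => [i'|] ->; case: (unliftP ord0 j) => [j'|] ->.
- rewrite (inj_eq (@lift_inj _ _)) => ij.
  rewrite dotp_sqrB !(dotpZl, dotpZr) !dotp_delta !mxE !eqxx/= eq_sym (negbTE ij) mulr0n.
  transitivity (2 * s ^+ 2); first by ring.
  by rewrite s2; ring.
- by rewrite sg.
- by rewrite dotp_subC sg.
- by rewrite eqxx.
Qed.

(* Answering with the midpoint of the projected vertices leaves all of them
   possible. *)
Lemma midpoint_answer n (p : 'I_n.+1 -> 'rV[R]_d) delta v :
  0 <= delta -> enorm v = 1 ->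
  (forall i j, dotp (p i - p j) (p i - p j) <= (2 * delta) ^+ 2) ->
  exists r : R, forall i, `|r - dotp (p i) v| <= delta.
Proof.
move=> delta0 v1 pD.
case: (@Order.TotalTheory.arg_maxP _ _ _ ord0 xpredT
  (fun i => dotp (p i) v) isT) => /= i _ imax.
case: (@Order.TotalTheory.arg_minP _ _ _ ord0 xpredT
  (fun i => dotp (p i) v) isT) => /= j _ jmin.
exists ((dotp (p i) v + dotp (p j) v) / 2) => k.
have := @dotp_unit_le _ _ _ v (2 * delta) _ v1 (pD i j).
rewrite dotpBl mulr_ge0// => /(_ isT) ij.
have := imax k isT; have := jmin k isT => h1 h2.
rewrite ler_norml; apply/andP; split; lra.
Qed.

(** Only unit vectors are queried, so answers off the sphere are never seen. *)
Lemma transcript_eq (query : seq R -> 'rV[R]_d) a b T :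
  (forall h, enorm (query h) = 1) ->
  (forall h v, enorm v = 1 -> a h v = b h v) ->
  transcript query a T = transcript query b T.
Proof. by move=> q1 ab; elim: T => //= T ->; rewrite ab. Qed.

(** Under uniform weights the average squared distance to [c] is at least the variance, which equals
    the stated bound. *)
Lemma exists_far_vertex (p : 'I_d.+1 -> 'rV[R]_d) delta c :
  (forall i j, i != j -> dotp (p i - p j) (p i - p j) = (2 * delta) ^+ 2) ->
  exists i, 2 * d%:R / (d%:R + 1) * delta ^+ 2 <= dotp (p i - c) (p i - c).
Proof.
move=> pE; apply: contrapT => /forallNP far.
have d0 : 0 < d%:R + 1 :> R by rewrite ltr_wpDl.
have e0 : 0 < (d%:R + 1)^-1 :> R by rewrite invr_gt0.
pose l (i : 'I_d.+1) : R := (d%:R + 1)^-1.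
have l1 : \sum_i l i = 1.
  by rewrite sumr_const card_ord -[LHS]mulr_natl -natr1 mulfV// gt_eqF.
have lp : wvar l p = 2 * d%:R / (d%:R + 1) * delta ^+ 2.
  have : 2 * wvar l p = 2 * (2 * d%:R / (d%:R + 1) * delta ^+ 2).
    rewrite wvar_pairs//.
    transitivity (\sum_(i < d.+1) d%:R * ((d%:R + 1)^-1 ^+ 2 * (2 * delta) ^+ 2)).
      apply: eq_bigr => i _.
      rewrite (bigD1 i)//= subrr dotp0l mulr0 add0r.
      under eq_bigr => j ij do rewrite pE 1?eq_sym// /l -expr2.
      by rewrite sumr_const cardC1 card_ord -[LHS]mulr_natl.
    rewrite sumr_const card_ord -[LHS]mulr_natl -natr1.
    by field; rewrite gt_eqF.
  lra.
have := dotp_ge0 (wmean l p - c).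
apply/negP; rewrite -ltNge.
have := wvar_center l p c l1.
have : \sum_i l i * dotp (p i - c) (p i - c) < \sum_i l i * wvar l p.
  apply: ltr_sum; first by apply/hasP; exists ord0; rewrite ?mem_index_enum.
  move=> i _; rewrite /l ltr_pM2l// -/l lp ltNge; apply/negP; exact: far.
rewrite -mulr_suml l1; lra.
Qed.

Lemma OPT_ge delta T : 0 <= delta ->
  ((Num.sqrt (2 * d%:R / (d%:R + 1)) * delta)%:E <= OPT d T delta)%E.
Proof.
move=> delta0.
have [p pE] := regular_simplex delta.
have pD i j : dotp (p i - p j) (p i - p j) <= (2 * delta) ^+ 2.
  have [->|/pE->//] := eqVneq i j.
  by rewrite subrr dotp0l sqr_ge0.
have /choice[r rP] v : exists r : R, enorm v = 1 ->
    forall i, `|r - dotp (p i) v| <= delta.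
  have [v1|v1] := pselect (enorm v = 1); last by exists 0.
  by have [r rP] := midpoint_answer _ _ _ _ delta0 v1 pD; exists r.
(* [valid_adv] constrains the answers to all vectors, whereas the common answer [r] is known to be
   legal only on the unit sphere; elsewhere the exact value serves. *)
pose a k (h : seq ('rV[R]_d * R)) v : R :=
  if enorm v == 1 then r v else dotp (p k) v.
have aP k : valid_adv (p k) delta (a k).
  move=> h v; rewrite /a; case: eqP => [v1|_]; first exact: rP.
  by rewrite subrr normr0.
apply: le_ereal_inf_tmp => _ [query [output [q1 ->]]].
(* All the [a k] produce the same transcript, so this output is the same for every vertex and [k]
   may be chosen after it. *)
set c := output (map snd (transcript query (a ord0) T)).
have [k kc] := exists_far_vertex p delta c pE.
apply: le_trans (_ : (recon_error query output (a k) (p k) T)%:E <= _)%E; last first.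
  by apply: ereal_sup_ubound; exists (p k), (a k).
rewrite lee_fin /recon_error.
rewrite (transcript_eq query (a k) (a ord0))//; last first.
  by move=> h v v1; rewrite /a v1 eqxx.
rewrite -/c enorm_ge ?mulr_ge0 ?sqrtr_ge0// exprMn sqr_sqrtr; last first.
  by rewrite divr_ge0 ?mulr_ge0// addr_ge0.
by rewrite dotp_subC.
Qed.

End LowerBound.

(** * Upper bound: a net of directions and consistent sets *)

Section UpperBound.
Context {R : realType} {d : nat}.
Implicit Types (delta eps : R) (x u v : 'rV[R]_d).

(* The integer vector obtained by rounding [m *: u] differs from it by at most
   1 in each coordinate. *)
Lemma grid_direction (m : nat) u : dotp u u = 1 ->
  exists f : {ffun 'I_d -> 'I_(m + m).+1},
    let z := \row_i ((f i)%:R - m%:R) in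
    m%:R - d%:R <= dotp u z /\ dotp z z <= (m%:R + d%:R) ^+ 2.
Proof.
move=> u1.
have ui i : `|u 0 i| <= 1.
  have : u 0 i * u 0 i <= 1.
    rewrite -u1 /dotp (bigD1 i)//= lerDl; apply: sumr_ge0 => j _.
    by rewrite -expr2 sqr_ge0.
  by rewrite -expr2 -real_normK ?num_real// -[X in _ <= X](expr1n _ 2) ler_sqr ?nnegrE.
have m0 : 0 <= m%:R :> R by [].
(* Truncating the shifted coordinate, which lies between 0 and 2m, gives an index in range. *)
have fi i : exists k : 'I_(m + m).+1, `|k%:R - m%:R - m%:R * u 0 i| <= 1.
  have := ui i; rewrite ler_norml => /andP[ul ur].
  have y0 : 0 <= m%:R * u 0 i + m%:R by nra.
  have /andP[kl kr] := truncn_itv y0.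
  have km : (Num.truncn (m%:R * u 0 i + m%:R)%R < (m + m).+1)%N.
    rewrite ltnS -(ler_nat R); apply: le_trans kl _; rewrite natrD; nra.
  exists (Ordinal km); rewrite /= ler_norml.
  move: kr; rewrite -natr1 => kr; apply/andP; split; lra.
have /choice[f fP] := fi.
exists (finfun f) => z.
pose e i : R := z 0 i - m%:R * u 0 i.
have ze i : z 0 i = m%:R * u 0 i + e i by rewrite /e; ring.
have e1 i : `|e i| <= 1 by rewrite /e !mxE ffunE.
have ue : `|\sum_i u 0 i * e i| <= d%:R.
  apply: le_trans (ler_norm_sum _ _ _) _.
  apply: le_trans (_ : \sum_(i < d) 1 <= _).
    apply: ler_sum => i _; rewrite normrM -[X in _ <= X](mul1r 1).
    exact: ler_pM.
  by rewrite sumr_const card_ord.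
have ee : \sum_i e i ^+ 2 <= d%:R.
  apply: le_trans (_ : \sum_(i < d) 1 <= _).
    apply: ler_sum => i _; rewrite -real_normK ?num_real//.
    by rewrite -[X in _ <= X](expr1n _ 2) ler_sqr ?nnegrE.
  by rewrite sumr_const card_ord.
have uu : \sum_i u 0 i * u 0 i = 1 by [].
move: ue; rewrite ler_norml => /andP[uel uer].
split.
  have -> : dotp u z = m%:R + \sum_i u 0 i * e i; last lra.
  transitivity (m%:R * (\sum_i u 0 i * u 0 i) + \sum_i u 0 i * e i).
    rewrite mulr_sumr -big_split; apply: eq_bigr => i _ /=.
    by rewrite ze; ring.
  by rewrite uu mulr1.
have -> : dotp z z = m%:R ^+ 2 + 2 * m%:R * \sum_i u 0 i * e i + \sum_i e i ^+ 2.
  transitivity (m%:R ^+ 2 * (\sum_i u 0 i * u 0 i)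
      + 2 * m%:R * (\sum_i u 0 i * e i) + \sum_i e i ^+ 2); last by rewrite uu mulr1.
  rewrite !mulr_sumr -!big_split; apply: eq_bigr => i _ /=.
  by rewrite ze; ring.
(* This absorbs the error term d into the square of m + d. *)
have : d%:R <= d%:R ^+ 2 :> R.
  by rewrite -natrX ler_nat; case: (d) => // n; rewrite -mulnn leq_pmulr.
nra.
Qed.

(** Normalised grid vectors form the net: the cosine between a direction and its rounding is at
    least (m - d) / (m + d), which exceeds [k] for large [m]. *)
Lemma sphere_net (k : R) : (0 < d)%N -> 0 <= k < 1 ->
  exists (N : nat) (v : nat -> 'rV[R]_d), (forall i, enorm (v i) = 1) /\
    forall w, exists2 i, (i < N)%N & k * enorm w <= dotp w (v i).
Proof.
move=> dgt0 /andP[k0 k1].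
have [m mP] : exists m : nat, d%:R * (1 + k) < m%:R * (1 - k).
  have k1' : 0 <= 1 - k by rewrite subr_ge0 ltW.
  have := Num.Theory.archi_boundP (x := d%:R * (1 + k) / (1 - k)).
  rewrite divr_ge0// ?mulr_ge0 ?(addr_ge0 ler01)// => /(_ isT).
  rewrite ltr_pdivrMr ?subr_gt0// => h; eexists; exact: h.
have d0 : 0 <= d%:R :> R by [].
have dk : k * (m%:R + d%:R) < m%:R - d%:R by lra.
have dm : 0 < m%:R - d%:R :> R by apply: le_lt_trans dk; rewrite mulr_ge0// addr_ge0.
pose e0 : 'rV[R]_d := delta_mx 0 (Ordinal dgt0).
have e01 : enorm e0 = 1.
  by rewrite /enorm dotp_delta mxE !eqxx sqrtr1.
pose z (f : {ffun 'I_d -> 'I_(m + m).+1}) : 'rV[R]_d := \row_i ((f i)%:R - m%:R).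
(* The grid contains the zero vector, and [nth] defaults to zero past its end; sending zero to [e0]
   keeps every query a unit vector. *)
pose nz w : 'rV[R]_d := if w == 0 then e0 else (enorm w)^-1 *: w.
have nz1 w : enorm (nz w) = 1.
  rewrite /nz; case: eqP => // /eqP w0.
  by rewrite /enorm dotp_normalize ?sqrtr1.
pose s := enum {ffun 'I_d -> 'I_(m + m).+1}.
exists (size s), (fun i => nz (nth 0 (map z s) i)); split=> // w.
have [->|w0] := eqVneq w 0.
  exists 0%N; last by rewrite dotp0l /enorm dotp0l sqrtr0 mulr0.
  by rewrite -cardE; apply/card_gt0P; exists [ffun=> ord0].
have ew := enorm_gt0 _ w0.
have [f [uf ff]] := grid_direction m _ (dotp_normalize _ w0).
rewrite -/(z f) dotpZl ler_pdivlMl// in uf ff *.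
have zf0 : z f != 0.
  apply: contraTneq uf => ->; rewrite dotpC dotp0l -ltNge mulr_gt0//.
have ez := enorm_gt0 _ zf0.
have fs : f \in s by rewrite mem_enum.
exists (index f s); first by rewrite index_mem.
rewrite (nth_map f) ?index_mem// nth_index// /nz (negbTE zf0) dotpZr.
rewrite ler_pdivlMl//; apply: le_trans uf.
rewrite mulrA [leLHS]mulrC ler_pM2l//.
apply: ltW; apply: le_lt_trans dk; rewrite mulrC ler_wpM2l//.
by rewrite enorm_le// addr_ge0.
Qed.

Lemma transcript_size (query : seq R -> 'rV[R]_d) a T :
  size (transcript query a T) = T.
Proof. by elim: T => //= T IH; rewrite size_rcons IH. Qed.

(** The round number is read off the length of the history, so answer [t] concerns [v t]. *)
Lemma transcript_nonadaptive (v : nat -> 'rV[R]_d) a x delta T :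
  valid_adv x delta a -> forall t, (t < T)%N ->
  `|nth 0 (map snd (transcript (fun h => v (size h)) a T)) t - dotp x (v t)| <= delta.
Proof.
move=> xa; elim: T => // T IH t; rewrite ltnS leq_eqVlt /= map_rcons nth_rcons.
rewrite size_map transcript_size => /orP[/eqP->|tT]; last by rewrite tT IH.
by rewrite ltnn eqxx; exact: xa.
Qed.

Lemma OPT_le delta eps : (0 < d)%N -> 0 < delta -> 0 < eps ->
  exists N, forall T, (N <= T)%N ->
  (OPT d T delta <= (Num.sqrt (2 * d%:R / (d%:R + 1)) * delta + eps)%:E)%E.
Proof.
move=> d0 delta0 eps0; set r := Num.sqrt _ * delta.
have d0' : 0 < d%:R :> R by rewrite ltr0n.
have q0 : 0 < 2 * d%:R / (d%:R + 1) :> R by rewrite divr_gt0 ?mulr_gt0 ?addr_gt0.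
have r0 : 0 < r by rewrite mulr_gt0// sqrtr_gt0.
have r2 : r ^+ 2 = 2 * d%:R / (d%:R + 1) * delta ^+ 2.
  by rewrite exprMn sqr_sqrtr// ltW.
(* Chosen so that [r / k], the Jung radius for diameter [2 * delta / k], stays below [r + eps]. *)
pose k := (r + eps / 2) / (r + eps).
have k0 : 0 < k by rewrite divr_gt0; lra.
have k1 : k < 1 by rewrite ltr_pdivrMr; lra.
have kr : r < k * (r + eps) by rewrite /k divfK ?gt_eqF; lra.
have [|N [v [v1 net]]] := sphere_net k d0; first by rewrite ltW.
exists N => T NT.
(* The secrets compatible with the first [N] answers. For an [h] not arising from play it may be
   empty, which [jung_approx] allows. *)
pose K (h : seq R) := [set x | forall t, (t < N)%N -> `|nth 0 h t - dotp x (v t)| <= delta].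
have /choice[output outP] h : exists c, forall q, K h q ->
    dotp (q - c) (q - c) <= (r + eps) ^+ 2.
  apply: (@jung_approx _ _ _ ((2 * delta / k) ^+ 2)).
    move=> x y Kx Ky; rewrite -enorm_le; last first.
      by rewrite ltW// (divr_gt0 _ k0) ?mulr_gt0.
    (* Both points are within [delta] of the same answer along [v i], and this direction captures a
       fraction [k] of their distance. *)
    have [i iN] := net (x - y).
    rewrite ler_pdivlMr// mulrC => /le_trans; apply.
    have := Kx _ iN; have := Ky _ iN; rewrite dotpBl !ler_norml.
    by move=> /andP[? ?] /andP[? ?]; lra.
  have -> : (2 * delta / k) ^+ 2 / 2 * (d%:R / (d%:R + 1)) = (r / k) ^+ 2.
    by rewrite [RHS]exprMn r2; field; rewrite !gt_eqF// addr_gt0.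
  have rk : r / k < r + eps by rewrite ltr_pdivrMr// mulrC.
  have rk0 : 0 < r / k by rewrite divr_gt0.
  by rewrite ltr_sqr ?nnegrE ?ltW// (lt_trans rk0).
apply: (@le_trans _ _ (worst_error (fun h => v (size h)) output T delta)).
  by apply: ereal_inf_lbound; exists (fun h => v (size h)), output.
apply: ge_ereal_sup => _ [x [a [xa ->]]].
rewrite lee_fin /recon_error enorm_le; last by rewrite addr_ge0 ?ltW.
set h := map _ _.
have : dotp (x - output h) (x - output h) <= (r + eps) ^+ 2.
  apply: outP => t tN; apply: transcript_nonadaptive => //.
  exact: leq_trans NT.
by rewrite dotp_subC.
Qed.

End UpperBound.

Theorem theorem1 (R : realType) (d : nat) (delta : R) :
  (1 <= d)%N -> 0 < delta ->
  (OPT d T delta) @[T --> \oo] -->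
    (Num.sqrt (2 * d%:R / (d%:R + 1)) * delta)%:E.
Proof.
move=> d0 delta0.
have lower T := @OPT_ge R d delta T (ltW delta0).
(* The two bounds make [OPT] eventually finite, which reduces the claim to a limit of reals. *)
apply/fine_cvgP; split.
  have [N NP] := OPT_le delta 1 d0 delta0 ltr01.
  exists N => // T /= /NP upper.
  by move: upper; have := lower T; case: (OPT d T delta).
apply/cvgrPdist_le => /= eps eps0.
have [N NP] := OPT_le delta eps d0 delta0 eps0.
exists N => // T /= /NP; have := lower T.
case: (OPT d T delta) => // o; rewrite !lee_fin /= ler_norml => h1 h2.
apply/andP; split; lra.
Qed.
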